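(* For all integers $\ell\ge 2$, we have $\tilde r(P_3,P_{\ell+1})=\lceil 5\ell/4\rceil$. Also, $$\tilde r(P_3,C_\ell)=\begin{cases}\ell+2 & \text{if } \ell=3,4,\\ \lceil 5\ell/4\rceil & \text{if } \ell\ge 5.\end{cases}$$
   Context: $P_s$ denotes the path on $s$ vertices and $C_s$ the cycle on $s$ vertices. Let $K_{\mathbb{N}}$ be the infinite complete graph on vertex set $\mathbb{N}$. In the $\tilde r(G,H)$-game, two players, Builder and Painter, play on the edge set of $K_{\mathbb{N}}$, with no edges coloured initially. In each round Builder chooses an edge and Painter colours it red or blue. Builder wins as soon as there is a red copy of $G$ or a blue copy of $H$. The on-line Ramsey number $\tilde r(G,H)$ is the minimum number of rounds within which Builder can guarantee to win, assuming both players play optimally (Builder minimising and Painter maximising the number of rounds). *)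

(* Defs.v *)
From mathcomp Require Import all_boot all_order all_algebra.

Set Implicit Arguments.
Unset Strict Implicit.
Unset Printing Implicit Defensive.

Record sgraph := SGraph {
  vertex :> finType;
  adj : rel vertex;
  adj_sym : symmetric adj;
  adj_irrefl : irreflexive adj }.

Section PathCycle.
Variable s : nat.

Definition path_adj : rel 'I_s :=
  fun i j => (j == i.+1 :> nat) || (i == j.+1 :> nat).

Lemma path_adj_sym : symmetric path_adj.
Proof. by move=> i j; rewrite /path_adj orbC. Qed.

Lemma path_adj_irrefl : irreflexive path_adj.
Proof. by move=> i; rewrite /path_adj orbb ltn_eqF. Qed.

Definition path_graph : sgraph := SGraph path_adj_sym path_adj_irrefl.

(* [ordS] is the cyclic successor on ['I_s].  The result is the cycle C_s only
   for 3 <= s; the conjunct [i != j] merely removes the loop when s = 1. *)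
Definition cycle_adj : rel 'I_s :=
  fun i j => (i != j) && ((ordS i == j) || (ordS j == i)).

Lemma cycle_adj_sym : symmetric cycle_adj.
Proof. by move=> i j; rewrite /cycle_adj eq_sym orbC. Qed.

Lemma cycle_adj_irrefl : irreflexive cycle_adj.
Proof. by move=> i; rewrite /cycle_adj eqxx. Qed.

Definition cycle_graph : sgraph := SGraph cycle_adj_sym cycle_adj_irrefl.

End PathCycle.

(* A finite set of edges of the complete graph on [nat] is given by a list of
   pairs; the order within a pair is irrelevant. *)
Definition edges := seq (nat * nat).

Definition joined (E : edges) (x y : nat) : bool :=
  ((x, y) \in E) || ((y, x) \in E).

(* Copies are subgraphs, not necessarily induced. *)
Definition has_copy (G : sgraph) (E : edges) : Prop :=
  exists2 f : G -> nat, injective f &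
    forall u v : G, adj u v -> joined E (f u) (f v).

(* From the position with red edges [R] and blue edges [B], Builder can
   guarantee to have won after at most [n] further rounds: either the game is
   already won, or some uncoloured edge [xy] leads to such a position for [n-1]
   whichever colour Painter gives it. *)
Fixpoint builder_wins (G H : sgraph) (n : nat) (R B : edges) : Prop :=
  has_copy G R \/ has_copy H B \/
  match n with
  | 0 => False
  | n'.+1 => exists x y : nat,
      [/\ x != y, ~~ joined R x y, ~~ joined B x y,
          builder_wins G H n' ((x, y) :: R) B &
          builder_wins G H n' R ((x, y) :: B)]
  end.

Definition online_ramsey_is (G H : sgraph) (n : nat) : Prop :=
  builder_wins G H n [::] [::] /\
  forall m : nat, builder_wins G H m [::] [::] -> n <= m.

(* Main.v *)
Require Import Defs.
From mathcomp Require Import all_boot all_order all_algebra.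
From mathcomp Require Import zify lra.
From Stdlib Require Import Classical.

Set Implicit Arguments.
Unset Strict Implicit.
Unset Printing Implicit Defensive.

(** Painter must keep the red edges a matching, for otherwise there is a red
    P_3; hence every further edge at an endpoint of a red edge is blue.  All
    the bounds compare the number of red edges with the blue edges that they
    force in this way.

    Lower bound 5l/4 ([greedy_painter]).  Painter colours an edge red whenever
    it meets no red edge.  Every blue edge then meets a red edge, so the ends
    of the red edges cover the blue path or cycle.  A vertex covers at most two
    of its l edges and a red edge has two ends, so at least l/4 edges are red,
    besides the l blue ones.

    Lower bound l + 2 for cycles ([lazy_painter]).  Painter colours an edge red
    only if it would complete a blue C_l.  To win within l + 1 rounds Builder
    would have to complete the same l - 1 blue edges to a C_l by two different
    edges, which is impossible, since the l - 1 edges already determine the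
    parity of every degree of the last one.

    Upper bound for paths ([extend_blue_path]).  A blue path with end a can be
    prolonged so that every red edge is paid for by four blue edges.  Builder
    plays an edge xy off the path.  If it is red, then a x b y c is forced.  If
    it is blue, Builder plays xz.  If that is red, then a x y z w is forced;
    if it is blue, Builder plays ay: red forces a z x y c, and blue prolongs
    the path by a y x z at the cost of three rounds.  Only when fewer than four
    edges are missing does Builder simply play an edge at a; a red answer then
    forces all the others.

    Upper bound for cycles ([cycle_upper]).  If the path starts at an end s of
    a red edge, the edge that closes it is forced, and costs no more than the
    rounding allows.  Builder obtains such a start by prolonging a blue path
    until the first red edge and then turning round ([cycle_after_red]).  If no
    red edge appears before the path has l vertices, Builder plays the closing
    edge; should it be red, two chords at its ends are forced and give a cycle
    on the same vertices ([close_cycle]).  The triangle is a finite game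
    ([triangle_upper]). *)

(** * Coloured edges and copies *)

Lemma joined_cons x y E u v :
  joined ((x, y) :: E) u v =
  [|| (u == x) && (v == y), (u == y) && (v == x) | joined E u v].
Proof.
rewrite /joined !inE !xpair_eqE (andbC (v == x)).
by case: (_ && _) => //=; case: (_ && _); rewrite ?orbT.
Qed.

Lemma joinedC E : symmetric (joined E).
Proof. by move=> x y; rewrite /joined orbC. Qed.

Lemma joined_subcons e E : subrel (joined E) (joined (e :: E)).
Proof. by case: e => a b x y xyE; rewrite joined_cons xyE !orbT. Qed.

Lemma joined_cons_mono e E E' : subrel (joined E) (joined E') ->
  subrel (joined (e :: E)) (joined (e :: E')).
Proof.
case: e => a b sEE' x y; rewrite !joined_cons.
by case/or3P=> [-> | -> | /sEE' ->]; rewrite ?orbT.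
Qed.

Lemma joined_cons_absorb x y E E' : joined E' x y ->
  subrel (joined E) (joined E') -> subrel (joined ((x, y) :: E)) (joined E').
Proof.
move=> xyE' sEE' u v; rewrite joined_cons.
by case/or3P=> [/andP[/eqP-> /eqP->] | /andP[/eqP-> /eqP->] | /sEE'] //; rewrite joinedC.
Qed.

Lemma has_copy_mono G E E' :
  subrel (joined E) (joined E') -> has_copy G E -> has_copy G E'.
Proof. by move=> sEE' [f f_inj fE]; exists f => // u v /fE/sEE'. Qed.

Lemma has_copy_P3 E x y z : x != y -> x != z -> y != z ->
  joined E x y -> joined E x z -> has_copy (path_graph 3) E.
Proof.
move=> xy xz yz Exy Exz; exists (fun i : 'I_3 => nth 0 [:: y; x; z] i).
  move=> i j /eqP; rewrite nth_uniq //; first by move/eqP/val_inj.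
  by rewrite /= !inE negb_or yz eq_sym xy xz.
move=> [[|[|[|?]]] ?] [[|[|[|?]]] ?] //=; by rewrite ?(joinedC _ _ x).
Qed.

(** The path with successive vertices [s], [q_1], [q_2] and so on: [s] stays
    fixed while Builder prolongs the path at [last s q]. *)
Definition blue_path (B : edges) s q := path (joined B) s q && uniq (s :: q).

Lemma blue_path_mono B B' s q : subrel (joined B) (joined B') ->
  blue_path B s q -> blue_path B' s q.
Proof. by move=> sBB' /andP[/(sub_path sBB') pq uq]; apply/andP. Qed.

Lemma blue_path_cat B B' s q t : subrel (joined B) (joined B') ->
  blue_path B s q -> path (joined B') (last s q) t -> uniq t ->
  ~~ has (mem (s :: q)) t -> blue_path B' s (q ++ t).
Proof.
move=> sBB' /andP[/(sub_path sBB') pq uq] pt ut dis.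
by rewrite /blue_path cat_path pq pt -cat_cons cat_uniq uq ut dis.
Qed.

Lemma has_copy_path B l s q : blue_path B s q -> size q = l ->
  has_copy (path_graph l.+1) B.
Proof.
case/andP=> pq uq sq; exists (fun i : 'I_l.+1 => nth s (s :: q) i).
  move=> i j /eqP; rewrite nth_uniq //= ?sq ?ltn_ord //.
  by move/eqP/val_inj.
have step (i j : 'I_l.+1) : j = i.+1 :> nat ->
    joined B (nth s (s :: q) i) (nth s (s :: q) j).
  move=> ji; rewrite ji /=; apply: (pathP s pq); by rewrite sq -ltnS -ji.
move=> i j /orP[/eqP/step // | /eqP/step]; by rewrite joinedC.
Qed.

Lemma has_copy_cycle B l s q : blue_path B s q -> joined B (last s q) s ->
  (size q).+1 = l -> has_copy (cycle_graph l) B.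
Proof.
case/andP=> pq uq close <-; set l' := (size q).+1.
exists (fun i : 'I_l' => nth s (s :: q) i).
  move=> i j /eqP; rewrite nth_uniq //= ?ltn_ord //.
  by move/eqP/val_inj.
have step (i : 'I_l') : joined B (nth s (s :: q) i) (nth s (s :: q) (ordS i)).
  have [lt | ge] := ltnP i (size q).
    by rewrite /= modn_small ?ltnS //=; apply: (pathP s pq).
  have iq : nat_of_ord i = size q.
    by apply/eqP; rewrite eqn_leq ge -ltnS ltn_ord.
  have -> : nat_of_ord (ordS i) = 0 by rewrite /= iq modnn.
  by rewrite iq -[X in nth s _ X]/(size (s :: q)).-1 nth_last.
move=> i j /andP[_ /orP[/eqP<- | /eqP<-]]; first exact: step.
rewrite joinedC; exact: step.
Qed.

(** * Builder's moves *)

Lemma builder_wins_red G H n R B : has_copy G R -> builder_wins G H n R B.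
Proof. by case: n => [|n]; left. Qed.

Lemma builder_wins_blue G H n R B : has_copy H B -> builder_wins G H n R B.
Proof. by case: n => [|n]; right; left. Qed.

Lemma builder_wins_leq G H m n R B :
  m <= n -> builder_wins G H m R B -> builder_wins G H n R B.
Proof.
elim: m n R B => [|m IHm] n R B.
  by move=> _ [|[|]] //; [apply: builder_wins_red | apply: builder_wins_blue].
case: n => // n mn [|[|[x [y [xy Rxy Bxy winR winB]]]]].
- by left.
- by right; left.
- by right; right; exists x, y; split=> //; apply: IHm.
Qed.

(** Extra coloured edges never hurt Builder: when the strategy asks for an edge
    that has a colour already, that round is skipped. *)
Lemma builder_wins_mono G H n R B R' B' :
  subrel (joined R) (joined R') -> subrel (joined B) (joined B') ->
  builder_wins G H n R B -> builder_wins G H n R' B'.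
Proof.
elim: n R B R' B' => [|n IHn] R B R' B' sR sB /=.
  by case=> [/(has_copy_mono sR) | [/(has_copy_mono sB) | ]]; tauto.
case=> [/(has_copy_mono sR) | [/(has_copy_mono sB) | ]]; [by left | by right; left |].
case=> x [y [xy _ _ winR winB]].
have [R'xy | R'xy] := boolP (joined R' x y).
  apply: (builder_wins_leq (leqnSn n)).
  exact: IHn (joined_cons_absorb R'xy sR) sB winR.
have [B'xy | B'xy] := boolP (joined B' x y).
  apply: (builder_wins_leq (leqnSn n)).
  exact: IHn sR (joined_cons_absorb B'xy sB) winB.
right; right; exists x, y; split=> //.
  by apply: IHn winR => //; apply: joined_cons_mono.
by apply: IHn winB => //; apply: joined_cons_mono.
Qed.

(** Consequently Builder may also propose edges that are already coloured, and
    strategies need not keep track of which edges are still uncoloured. *)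
Lemma play_edge G H n R B x y : x != y ->
  builder_wins G H n ((x, y) :: R) B -> builder_wins G H n R ((x, y) :: B) ->
  builder_wins G H n.+1 R B.
Proof.
move=> xy winR winB.
have [Rxy | Rxy] := boolP (joined R x y).
  apply: (@builder_wins_leq _ _ n) => //.
  by apply: builder_wins_mono winR => //; apply: joined_cons_absorb.
have [Bxy | Bxy] := boolP (joined B x y).
  apply: (@builder_wins_leq _ _ n) => //.
  by apply: builder_wins_mono winB => //; apply: joined_cons_absorb.
by right; right; exists x, y.
Qed.

(** The red edge [xz] leaves Painter no choice for [xy]: red would complete the
    red P_3 [y x z]. *)
Lemma force_blue H n R B x y z : x != y -> z != x -> z != y -> joined R x z ->
  builder_wins (path_graph 3) H n R ((x, y) :: B) ->
  builder_wins (path_graph 3) H n.+1 R B.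
Proof.
move=> xy zx zy Rxz; apply: (play_edge xy); apply: builder_wins_red.
apply: (@has_copy_P3 _ x y z) => //; rewrite 1?eq_sym ?joined_cons ?eqxx //.
by rewrite Rxz !orbT.
Qed.

(** * Blue paths *)

(** The ceiling of [5 * r / 4]. *)
Definition rounds r := (5 * r + 3) %/ 4.

Lemma fresh_bound (s : seq nat) : exists N, {in s, forall x, x < N}.
Proof.
exists (sumn s).+1; elim: s => [|y s IHs] x //=; rewrite inE ltnS.
case/predU1P=> [-> | /IHs]; lia.
Qed.

Ltac solve_joined :=
  first [by rewrite /= ?joined_cons ?eqxx /= ?orbT | by apply: joined_subcons].

(* Builder plays [xy]; it must become blue since [xz] is red. *)
Ltac force x y z :=
  apply: (@force_blue _ _ _ _ x y z); [lia | lia | lia | solve_joined |].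

Ltac solve_subrel :=
  let e := fresh in by move=> ? ? e; rewrite ?joined_cons e ?orbT.

Ltac extend_by leaf t :=
  apply: (leaf t); [solve_subrel | solve_subrel | solve_joined
    | rewrite /= ?inE; lia | rewrite /=; lia | rewrite /=; lia
    | rewrite /rounds /=; lia].

(** Stated in continuation form: whatever Builder achieves in [m] rounds from
    every blue path with [k] edges, Builder achieves in [rounds r + m] rounds
    from a blue path lacking [r] edges.  The vertex [w] is the one at which the
    path must not end; for cycles it is the red neighbour of [s], as [s] cannot
    be joined to it by a blue edge.  The induction is on the number of missing
    edges; at most five rounds are spent for the next four of them. *)
Lemma extend_blue_path H k m w s r q R B :
  (forall R' B' q', subrel (joined R) (joined R') -> blue_path B' s q' ->
     last s q' != w -> size q' = k -> builder_wins (path_graph 3) H m R' B') ->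
  blue_path B s q -> last s q != w -> size q + r = k ->
  builder_wins (path_graph 3) H (rounds r + m) R B.
Proof.
elim/ltn_ind: r q R B => r IHr q R B win qB qw sq.
have [r0 | r_gt0] := posnP r.
  by rewrite r0; apply: (win R B q) => //; lia.
have [N Nfresh] := fresh_bound (w :: s :: q).
have wN : w < N by apply: Nfresh; rewrite inE eqxx.
set a := last s q in qw *.
have aN : a < N by apply: Nfresh; rewrite inE mem_last orbT.
(* The induction hypothesis after a gain of the path [t] beyond [a]. *)
have leaf t n R' B' : subrel (joined R) (joined R') ->
    subrel (joined B) (joined B') ->
    path (joined B') a t -> uniq t -> all (leq N) t -> 0 < size t <= r ->
    rounds (r - size t) + m <= n -> builder_wins (path_graph 3) H n R' B'.
  move=> sR sB pt ut Nt /andP[t_gt0 tr] /builder_wins_leq; apply.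
  apply: (IHr _ _ (q ++ t)).
  - by rewrite ltn_subrL t_gt0 r_gt0.
  - by move=> R2 B2 q2 sR2; apply: win => x y /sR /sR2.
  - apply: (blue_path_cat sB) => //; apply/hasPn => x /(allP Nt) Nx.
    apply/negP=> /= xq; suff: x < N by lia.
    by apply: Nfresh; rewrite inE xq orbT.
  - rewrite last_cat -/a; case: t t_gt0 Nt {pt ut tr} => // y t _ Nt.
    have := allP Nt _ (mem_last y t); rewrite /=; lia.
  - rewrite size_cat; lia.
(* For r < 4 the allowance is r + 1 rounds, which leaves room for one red edge. *)
have [r_lt4 | r_ge4] := ltnP r 4.
  have -> : rounds r + m = (r + m).+1 by rewrite /rounds; lia.
  apply: (@play_edge _ _ _ _ _ a N); first by lia.
    case: r r_gt0 r_lt4 {win IHr sq} leaf => [|[|[|[|r]]]] // _ _ leaf; rewrite !addSn.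
    - force a N.+1 N; extend_by leaf [:: N.+1].
    - force a N.+1 N; force N N.+1 a; extend_by leaf [:: N.+1; N].
    - force a N.+1 N; force N N.+1 a; force N N.+2 a.
      extend_by leaf [:: N.+1; N; N.+2].
  extend_by leaf [:: N].
have -> : rounds r + m = (rounds (r - 4) + m).+4.+1 by rewrite /rounds; lia.
apply: (@play_edge _ _ _ _ _ N N.+1); first by lia.
  force N a N.+1; force N N.+2 N.+1; force N.+1 N.+2 N; force N.+1 N.+3 N.
  extend_by leaf [:: N; N.+2; N.+1; N.+3].
apply: (@play_edge _ _ _ _ _ N N.+2); first by lia.
  force N a N.+2; force N.+2 N.+1 N; force N.+2 N.+3 N.
  extend_by leaf [:: N; N.+1; N.+2; N.+3].
apply: (@play_edge _ _ _ _ _ a N.+1); first by lia.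
  force a N.+2 N.+1; force N.+1 N.+3 a.
  extend_by leaf [:: N.+2; N; N.+1; N.+3].
extend_by leaf [:: N.+1; N; N.+2].
Qed.

Lemma path_upper l :
  builder_wins (path_graph 3) (path_graph l.+1) (rounds l) [::] [::].
Proof.
rewrite -[rounds l]addn0.
(* Any vertex other than the start 0 serves as the excluded end. *)
apply: (@extend_blue_path _ l 0 1 0 l [::]) => // R B q _ qB _ sq.
exact: builder_wins_blue (has_copy_path qB sq).
Qed.

(** * Blue cycles *)

Lemma last_neq_head B s q : blue_path B s q -> 0 < size q -> s != last s q.
Proof.
case: q => //= x q /andP[_ /andP[sq _]] _.
by apply: contraNneq sq => {1}->; apply: mem_last.
Qed.

(** The closing edge of the cycle joins the last vertex to [s], whose red edge
    [sw] forces it to be blue. *)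
Lemma finish_cycle l (w s : nat) r q R B : 1 < l -> joined R s w -> w != s ->
  blue_path B s q -> last s q != w -> (size q + r).+1 = l ->
  builder_wins (path_graph 3) (cycle_graph l) (rounds r).+1 R B.
Proof.
move=> l_gt1 sw ws qB qw lE; rewrite -[(rounds r).+1]addn1.
apply: (@extend_blue_path _ l.-1 1 w s r q) => //; last by lia.
move=> R' B' q' sR q'B q'w sq'.
have q'_gt0 : 0 < size q' by lia.
apply: (@force_blue _ _ _ _ s (last s q') w) => //.
- exact: last_neq_head q'B q'_gt0.
- by rewrite eq_sym.
- exact: sR.
apply/builder_wins_blue/(has_copy_cycle (blue_path_mono _ q'B)); last by lia.
  exact: joined_subcons.
by rewrite joined_cons !eqxx orbT.
Qed.

(** Let the blue Hamiltonian path be [s ... c b z].  If Painter colours [sz]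
    red, then [zc] and [sb] are forced, and replacing the edge [cb] of the path
    by these two gives the cycle [s ... c z b]. *)
Lemma close_cycle l s q R B : 3 < l -> blue_path B s q -> (size q).+1 = l ->
  builder_wins (path_graph 3) (cycle_graph l) 3 R B.
Proof.
move=> l_gt3 qB lE; apply: (@play_edge _ _ _ _ _ s (last s q)).
- by apply: last_neq_head qB _; lia.
- case/lastP: q qB lE => [|q z]; first by rewrite /= => _; lia.
  case/lastP: q => [|q b]; first by rewrite /= => _; lia.
  rewrite last_rcons /blue_path !rcons_path !last_rcons -!rcons_cons.
  rewrite !rcons_uniq !mem_rcons !inE !negb_or !size_rcons.
  case/andP=> /andP[/andP[pq qb] bz].
  case/and3P=> /and3P[zb zs zq] /andP[bs bq] suq lE.
  set c := last s q.
  have q_gt0 : 0 < size q by lia.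
  have cq : c \in q by rewrite /c; case: (q) q_gt0 => //= x q' _; apply: mem_last.
  have cs : s != c by apply: (@last_neq_head B) => //; rewrite /blue_path pq.
  have cz : c != z by apply: contraNneq zq => <-.
  have cb : c != b by apply: contraNneq bq => <-.
  apply: (@force_blue _ _ _ _ z c s) => //; try by rewrite eq_sym.
    by rewrite joined_cons !eqxx orbT.
  apply: (@force_blue _ _ _ _ s b z) => //; try by rewrite eq_sym.
    by rewrite joined_cons !eqxx.
  apply: builder_wins_blue; apply: (@has_copy_cycle _ _ s (q ++ [:: z; b])).
  - apply: (@blue_path_cat B); first by solve_subrel.
    + by rewrite /blue_path pq.
    + rewrite /= !joined_cons -/c !eqxx /= ?orbT /=.
      by rewrite [joined B z b]joinedC bz !orbT.
    + by rewrite /= inE zb.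
    + by rewrite /= !inE !negb_or zs zq bs bq.
  - by rewrite last_cat /= joined_cons !eqxx orbT.
  - by rewrite size_cat /=; lia.
- apply/builder_wins_blue/(has_copy_cycle (blue_path_mono _ qB)) => //.
    exact: joined_subcons.
  by rewrite joined_cons !eqxx orbT.
Qed.

(** All [size q] edges of the path were played blue before the red edge [sw].
    With at least three of them, the round lost to the red edge is already paid for and
    the path can be prolonged at its other end.  With fewer, the end [w] of the
    red edge is used as well: it gets two forced blue edges inside the path.
    The path with two edges is too long for this when [l = 4]; there the
    allowance is six rounds instead of five. *)
Lemma cycle_after_red l (w s : nat) q R B : 3 < l -> joined R s w ->
  w \notin s :: q -> blue_path B s q -> (size q).+1 < l ->
  builder_wins (path_graph 3) (cycle_graph l)
    (maxn (rounds l) l.+2 - (size q).+1) R B.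
Proof.
move=> l_gt3 sw wq qB ql.
have ws : w != s by move: wq; rewrite inE negb_or => /andP[].
have qw : last s q != w by apply: contraNneq wq => <-; apply: mem_last.
have [N Nfresh] := fresh_bound (w :: s :: q).
have wN : w < N by apply: Nfresh; rewrite inE eqxx.
(* Forced edges first prolong the path by [t] and a fresh vertex, at which
   [finish_cycle] takes over. *)
have finish t R' B' : joined R' s w -> subrel (joined B) (joined B') ->
    path (joined B') (last s q) (rcons t N) -> uniq (rcons t N) ->
    ~~ has (mem (s :: q)) t -> size q + (size t).+1 < l ->
    builder_wins (path_graph 3) (cycle_graph l)
      (rounds (l.-1 - (size q + (size t).+1))).+1 R' B'.
  move=> sw' sB pt ut dt lt.
  apply: (@finish_cycle l w s _ (q ++ rcons t N)) => //; first by lia.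
  - apply: (blue_path_cat sB) => //; rewrite has_rcons negb_or dt andbT.
    by apply/negP=> /= Nq; have := Nfresh N; rewrite inE Nq orbT ltnn => /(_ isT).
  - by rewrite last_cat last_rcons; lia.
  - by rewrite size_cat size_rcons; lia.
have [q_ge3 | q_lt3] := leqP 3 (size q).
  apply: (@builder_wins_leq _ _ (rounds (l.-1 - size q)).+1).
    by rewrite /rounds; lia.
  by apply: (finish_cycle _ sw ws qB qw); lia.
have sN : s < N by apply: Nfresh; rewrite !inE eqxx orbT.
have ws' : joined R w s by rewrite joinedC.
have [q0 | q_gt0] := posnP (size q).
  apply: (@builder_wins_leq _ _ (rounds (l - 4)).+4); first by rewrite /rounds; lia.
  case: q q0 {ql qB wq qw Nfresh q_lt3} finish => // _ finish.
  force s N.+1 w; force w N.+1 s; force w N s.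
  have -> : l - 4 = l.-1 - (0 + 3) by lia.
  apply: (finish [:: N.+1; w]) => //; [solve_subrel | solve_joined | |].
  - by rewrite /= !inE; lia.
  - by rewrite /= !inE; lia.
set a := last s q in qw finish.
have aN : a < N by apply: Nfresh; rewrite inE mem_last orbT.
have sa : s != a := last_neq_head qB q_gt0.
have [ql_gt | ql_le] := ltnP (size q).+2 l.
  apply: (@builder_wins_leq _ _ (rounds (l.-1 - (size q + 2))).+3).
    by rewrite /rounds; lia.
  force w a s; force w N s.
  apply: (finish [:: w]) => //; [solve_subrel | solve_joined | | | ].
  - by rewrite /= !inE; lia.
  - by rewrite /= orbF.
  - by rewrite /=; lia.
have {ql ql_le q_gt0 q_lt3 finish l_gt3} [lE sq] : l = 4 /\ size q = 2 by lia.
rewrite lE sq -[_ - _]/3.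
have cycle_with x R' B' : N <= x -> subrel (joined B) (joined B') ->
    joined B' a x -> joined B' x s ->
    builder_wins (path_graph 3) (cycle_graph 4) 0 R' B'.
  move=> Nx sB ax xs.
  apply/builder_wins_blue/(@has_copy_cycle _ _ s (q ++ [:: x])).
  - apply: (blue_path_cat sB) => //; first by rewrite /= andbT.
    rewrite /= orbF; apply/negP=> xq; have := Nfresh x.
    by rewrite inE xq orbT ltnNge Nx => /(_ isT).
  - by rewrite last_cat.
  - by rewrite size_cat sq.
apply: (@play_edge _ _ _ _ _ a N); first by lia.
  force a N.+1 N; force s N.+1 w.
  by apply: (cycle_with N.+1) => //; [solve_subrel | solve_joined | solve_joined].
apply: (@builder_wins_leq _ _ 1) => //; force s N w.
by apply: (cycle_with N) => //; [solve_subrel | solve_joined | solve_joined].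
Qed.

(** Builder prolongs the blue path at its head until the first red answer.  The
    term [l.+2] of the bound is the cost of the case without such an answer;
    it exceeds [rounds l] only for [l = 4]. *)
Lemma cycle_upper l : 3 < l ->
  builder_wins (path_graph 3) (cycle_graph l) (maxn (rounds l) l.+2) [::] [::].
Proof.
move=> l_gt3.
have grow d s q B : blue_path B s q -> size q + d = l.-1 ->
    builder_wins (path_graph 3) (cycle_graph l)
      (maxn (rounds l) l.+2 - size q) [::] B.
  elim: d s q B => [|d IHd] s q B qB sq.
    by apply: (@builder_wins_leq _ _ 3); [lia | apply: (@close_cycle _ s q) => //; lia].
  have [N Nfresh] := fresh_bound (s :: q).
  have sN : s < N by apply: Nfresh; rewrite inE eqxx.
  have Nq : N \notin s :: q by apply/negP=> /Nfresh; rewrite ltnn.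
  apply: (@builder_wins_leq _ _ (maxn (rounds l) l.+2 - (size q).+1).+1); first by lia.
  apply: (@play_edge _ _ _ _ _ s N); first by lia.
    by apply: (@cycle_after_red _ N s) => //; [solve_joined | lia].
  apply: (IHd N (s :: q)); last by rewrite /=; lia.
  case/andP: qB => pq uq; rewrite /blue_path /= Nq andTb.
  rewrite joined_cons !eqxx orbT; apply/andP; split=> //.
  by apply: sub_path pq; apply: joined_subcons.
rewrite -[maxn _ _]subn0; exact: (grow l.-1 0 [::] [::]).
Qed.

(** A red closing edge cannot be repaired by chords here, as a triangle has
    none; the game tree below avoids it within five rounds. *)
Lemma triangle_upper : builder_wins (path_graph 3) (cycle_graph 3) 5 [::] [::].
Proof.
have triangle n x y z R B : uniq [:: x; y; z] -> joined B x y -> joined B y z ->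
    joined B z x -> builder_wins (path_graph 3) (cycle_graph 3) n R B.
  move=> xyz xy yz zx; apply: builder_wins_blue.
  by apply: (@has_copy_cycle _ _ x [:: y; z]) => //; rewrite /blue_path /= xy yz.
apply: (@play_edge _ _ _ _ _ 0 1) => //.
  apply: (@play_edge _ _ _ _ _ 2 3) => //.
    by force 0 2 1; force 0 4 1; force 2 4 3; apply: (triangle _ 0 2 4).
  by force 0 2 1; force 0 3 1; apply: (triangle _ 0 2 3).
apply: (@play_edge _ _ _ _ _ 0 2) => //.
  apply: (@play_edge _ _ _ _ _ 1 3) => //.
    by force 0 4 2; force 1 4 3; apply: (triangle _ 0 1 4).
  by force 0 3 2; apply: (triangle _ 0 1 3).
apply: (@play_edge _ _ _ _ _ 0 3) => //.
  apply: (@play_edge _ _ _ _ _ 1 4) => //.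
    by force 1 2 4; apply: (triangle _ 0 1 2).
  by force 0 4 3; apply: (triangle _ 0 1 4).
apply: (@play_edge _ _ _ _ _ 1 2) => //.
  by force 1 3 2; apply: (triangle _ 0 1 3).
by apply: (triangle _ 0 1 2).
Qed.

(** * Painter's invariants *)

(** A strategy of Painter is an invariant [I] of positions that one of the two
    colours always restores. *)
Lemma painter_bound G H N (I : edges -> edges -> Prop) n R B :
  (forall R B, I R B -> has_copy G R \/ has_copy H B -> N <= size R + size B) ->
  (forall R B x y, I R B -> x != y -> ~~ joined R x y -> ~~ joined B x y ->
     I ((x, y) :: R) B \/ I R ((x, y) :: B)) ->
  I R B -> builder_wins G H n R B -> N <= size R + size B + n.
Proof.
move=> Iend Istep.
have over R' B' n' : I R' B' -> has_copy G R' \/ has_copy H B' ->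
    N <= size R' + size B' + n'.
  by move=> IRB /(Iend _ _ IRB) /leq_trans; apply; apply: leq_addr.
elim: n R B => [|n IHn] R B IRB /=.
  by case=> [|[|//]] won; apply: over; tauto.
case=> [|[|[x [y [xy Rxy Bxy winR winB]]]]]; try by move=> won; apply: over; tauto.
case: (Istep R B x y IRB xy Rxy Bxy) => [/IHn/(_ winR) | /IHn/(_ winB)] /=; lia.
Qed.

Definition ends (E : edges) := flatten [seq [:: e.1; e.2] | e <- E].

Lemma size_ends E : size (ends E) = 2 * size E.
Proof. by elim: E => //= e E IHE; rewrite IHE; lia. Qed.

Lemma joined_ends E x y : joined E x y -> x \in ends E.
Proof.
elim: E => //= -[a b] E IHE; rewrite joined_cons !inE /=.
by case/or3P=> [/andP[->] | /andP[->] | /IHE ->] //; rewrite ?orbT.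
Qed.

Lemma matching_no_P3 E : uniq (ends E) -> ~ has_copy (path_graph 3) E.
Proof.
have partner x y z : uniq (ends E) -> joined E x y -> joined E x z -> y = z.
  elim: E => //= -[a b] E IHE /=; rewrite inE negb_or => /and3P[/andP[ab aE] bE uE].
  have aN u : joined E a u = false by apply/negP=> /joined_ends; rewrite (negPf aE).
  have bN u : joined E b u = false by apply/negP=> /joined_ends; rewrite (negPf bE).
  rewrite !joined_cons => /or3P[/andP[/eqP-> /eqP->] | /andP[/eqP-> /eqP->] |].
  - by rewrite eqxx (negPf ab) aN /= !orbF => /eqP->.
  - by rewrite eqxx eq_sym (negPf ab) bN /= ?orbF => /eqP->.
  - case: (x =P a) => [-> | _]; first by rewrite aN.
    case: (x =P b) => [-> | _]; first by rewrite bN.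
    exact: IHE.
move=> uE [f f_inj fE].
pose i0 : 'I_3 := inord 0; pose i1 : 'I_3 := inord 1; pose i2 : 'I_3 := inord 2.
have E10 : joined E (f i1) (f i0) by apply: fE; rewrite /= /path_adj !inordK.
have E12 : joined E (f i1) (f i2) by apply: fE; rewrite /= /path_adj !inordK.
by have /f_inj/(congr1 val) := partner _ _ _ uE E10 E12; rewrite /= !inordK.
Qed.

(** * Edge counts of paths and cycles *)

(** Paths and cycles with [l] edges at once: the i-th edge joins [u i] to [v i],
    where [v i] is the successor of [u i] in the direction of traversal, so each
    vertex occurs at most once as a tail and at most once as a head.  The third
    clause excludes going back along an edge. *)
Definition trail l (u v : 'I_l -> nat) (E : edges) :=
  [/\ injective u, injective v, forall i j, u i = v j -> v i <> u j
    & forall i, joined E (u i) (v i)].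

Lemma trail_of_path l E : has_copy (path_graph l.+1) E ->
  exists u v : 'I_l -> nat, trail u v E.
Proof.
case=> f f_inj fE; exists (fun i => f (inord i)), (fun i => f (inord i.+1)).
have small (i : 'I_l) : i < l.+1 by apply: leqW.
have small1 (i : 'I_l) : i.+1 < l.+1 by rewrite ltnS.
split=> [i j /f_inj/(congr1 val) | i j /f_inj/(congr1 val) | i j | i].
- by rewrite /= !inordK // => /val_inj.
- by rewrite /= !inordK // => -[/val_inj].
- move=> /f_inj/(congr1 val) /= ij /f_inj/(congr1 val) /=; move: ij.
  by rewrite !inordK //; lia.
- by apply: (fE (inord i) (inord i.+1)); rewrite /= /path_adj !inordK ?eqxx.
Qed.

Lemma ordS_ordS_neq l (i : 'I_l) : 2 < l -> ordS (ordS i) != i.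
Proof.
move=> l_gt2; rewrite -val_eqE /= -addn1 modnDml addn1.
have il := ltn_ord i; have [lt | ge] := ltnP i.+2 l.
  by rewrite modn_small //; lia.
by rewrite -(subnK ge) modnDr modn_small; lia.
Qed.

Lemma ordS_neq l (i : 'I_l) : 1 < l -> ordS i != i.
Proof.
move=> l_gt1; rewrite -val_eqE /=.
have il := ltn_ord i; have [lt | ge] := ltnP i.+1 l.
  by rewrite modn_small //; lia.
by rewrite -(subnK ge) modnDr modn_small; lia.
Qed.

Lemma trail_of_cycle l E : 2 < l -> has_copy (cycle_graph l) E ->
  exists2 u : 'I_l -> nat, injective u & trail u (u \o @ordS l) E.
Proof.
move=> l_gt2 [f f_inj fE]; exists f => //; split=> //.
- by apply: inj_comp => //; apply: ordS_inj.
- move=> i j /f_inj-> /f_inj/eqP; apply/negP; exact: ordS_ordS_neq.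
- move=> i; apply: fE; rewrite /= /cycle_adj eqxx eq_sym ordS_neq //; lia.
Qed.

(** The form in which an undirected edge is listed in [E]. *)
Definition orient (E : edges) x y := if (x, y) \in E then (x, y) else (y, x).

Lemma orient_in E x y : joined E x y -> orient E x y \in E.
Proof. by rewrite /orient /joined; case: ifP. Qed.

Lemma trail_uniq l (u v : 'I_l -> nat) E : trail u v E ->
  uniq [seq orient E (u i) (v i) | i : 'I_l] /\
  {subset [seq orient E (u i) (v i) | i : 'I_l] <= E}.
Proof.
case=> u_inj v_inj uv uvE; split; last first.
  by move=> e /mapP[i _ ->]; apply/orient_in/uvE.
rewrite map_inj_uniq ?enum_uniq // => i j; rewrite /orient.
case: ifP => _; case: ifP => _ [].
- by move/u_inj.
- by move=> /uv.
- by move=> /esym uj /esym/(uv _ _ uj).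
- by move=> _ /u_inj.
Qed.

Lemma size_trail l (u v : 'I_l -> nat) E : trail u v E -> l <= size E.
Proof.
by case/trail_uniq=> /uniq_leq_size le /le; rewrite size_map -cardE card_ord.
Qed.

Definition covers (V : seq nat) (E : edges) :=
  forall x y, joined E x y -> (x \in V) || (y \in V).

(** Each vertex of the cover is met at most once as a tail and at most once as
    a head. *)
Lemma trail_cover l (u v : 'I_l -> nat) E V : trail u v E -> covers V E ->
  l <= 2 * size V.
Proof.
case=> u_inj v_inj _ uvE cov.
have few (w : 'I_l -> nat) : injective w -> #|[pred i | w i \in V]| <= size V.
  move=> w_inj; rewrite cardE -(size_map w); apply: uniq_leq_size.
    by rewrite map_inj_uniq ?enum_uniq.
  by move=> x /mapP[i]; rewrite mem_enum inE => wi ->.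
have := leq_add (few u u_inj) (few v v_inj).
rewrite addnn -mul2n; apply: leq_trans; rewrite -cardUI.
apply: leq_trans (leq_addr _ _); rewrite -[X in X <= _]card_ord.
by apply: subset_leq_card; apply/subsetP=> i _; rewrite !inE cov.
Qed.

(** * The greedy and the lazy Painter *)

(** Painter colours red exactly the edges that meet no red edge; that the red
    edges form a matching is expressed by the absence of repetitions in the list
    of their ends. *)
Lemma greedy_painter l H n :
  (forall E, has_copy H E -> exists u v : 'I_l -> nat, trail u v E) ->
  builder_wins (path_graph 3) H n [::] [::] -> rounds l <= n.
Proof.
move=> trailH.
pose I R B := uniq (ends R) /\ covers (ends R) B.
apply: (@painter_bound _ _ _ I) => //.
- move=> R B [uR cov] [/(matching_no_P3 uR) // | /trailH[u [v uv]]].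
  have := size_trail uv; have := trail_cover uv cov; rewrite size_ends /rounds; lia.
- move=> R B x y [uR cov] xy _ _.
  have [xyR | ] := boolP ((x \in ends R) || (y \in ends R)).
    right; split=> // a b; rewrite joined_cons.
    case/or3P=> [/andP[/eqP-> /eqP->] | /andP[/eqP-> /eqP->] | /cov] //.
    by rewrite orbC.
  rewrite negb_or => /andP[xR yR]; left; split=> [|a b /cov].
    by rewrite /= inE negb_or xy xR yR.
  by rewrite !inE => /orP[] ->; rewrite !orbT.
Qed.

Definition degree (E : edges) z := \sum_(e <- E) ((e.1 == z) + (e.2 == z)).

(** Since [E] has no more edges than the cycle, it consists of the cycle, in
    which all degrees are even. *)
Lemma degree_tight_cycle l E z : 2 < l -> has_copy (cycle_graph l) E ->
  size E = l -> ~~ odd (degree E z).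
Proof.
move=> l_gt2 /(trail_of_cycle l_gt2)[u u_inj /trail_uniq[uniqS sSE]] sE.
set S := [seq _ | i : 'I_l] in uniqS sSE.
have sS : size E <= size S by rewrite sE size_map -cardE card_ord.
have uE : uniq E by rewrite (leq_size_uniq uniqS sSE sS).
have SE : S =i E by case: (uniq_min_size uniqS sSE sS).
have -> : degree E z = \sum_(e <- S) ((e.1 == z) + (e.2 == z)).
  by apply/esym/perm_big/uniq_perm.
have -> : \sum_(e <- S) ((e.1 == z) + (e.2 == z)) =
    \sum_(i < l) ((u i == z) + (u (ordS i) == z)).
  rewrite big_map big_enum /=; apply: eq_bigr => i _; rewrite /orient.
  by case: ifP => //= _; rewrite addnC.
rewrite big_split /= -(reindex_inj (@ordS_inj l) (P := xpredT)
  (F := fun i => nat_of_bool (u i == z))) addnn.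
by rewrite odd_double.
Qed.

(** The degree parities of [B] determine the two vertices of the missing edge. *)
Lemma tight_cycle_edge_unique l B x y x' y' : 2 < l -> (size B).+1 = l ->
  x != y -> has_copy (cycle_graph l) ((x, y) :: B) ->
  has_copy (cycle_graph l) ((x', y') :: B) -> joined [:: (x, y)] x' y'.
Proof.
move=> l_gt2 sB xy copy copy'.
have same z : odd ((x == z) + (y == z)) = odd ((x' == z) + (y' == z)).
  have := degree_tight_cycle z l_gt2 copy sB.
  have := degree_tight_cycle z l_gt2 copy' sB.
  rewrite /degree !big_cons /= -/(degree B z) !oddD !oddb.
  by case: (odd (degree B z)); case: (x == z); case: (y == z); case: (x' == z); case: (y' == z).
rewrite joined_cons; have := same x; have := same y.
rewrite !eqxx (eq_sym y x) (negPf xy) !oddD !oddb.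
have [-> | _] := eqVneq x' x; first by rewrite (negPf xy); case: (y' == y).
have [-> | _] := eqVneq x' y; first by case: (y' == x).
have [-> | _] := eqVneq y' x; first by rewrite (negPf xy).
by case: (y' == y).
Qed.

(** Before round [l + 2] there is no blue C_l and at most one red edge, which
    would have completed a blue C_l.  A second edge completing one is coloured
    blue, but Builder plays it too late: by [tight_cycle_edge_unique] at least
    [l] other edges are blue by then, besides the red one. *)
Lemma lazy_painter l n : 2 < l ->
  builder_wins (path_graph 3) (cycle_graph l) n [::] [::] -> l.+2 <= n.
Proof.
move=> l_gt2; pose C := cycle_graph l.
have size_copy E : has_copy C E -> l <= size E.
  by case/(trail_of_cycle l_gt2)=> u _ /size_trail.
pose I (R B : edges) := l.+2 <= size R + size B \/ ~ has_copy C B /\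
  (R = [::] \/ exists x y, [/\ x != y, R = [:: (x, y)] & has_copy C ((x, y) :: B)]).
apply: (@painter_bound _ _ _ I).
- move=> R B [// | [noC [-> | [x [y [xy -> _]]]]]] [|//] /matching_no_P3 [] //.
  by rewrite /= inE xy.
- move=> R B x y [big _ _ _ | [noC RE] xy Rxy Bxy].
    by left; left; rewrite /=; lia.
  have [closes | open] := classic (has_copy C ((x, y) :: B)); last first.
    right; right; split=> //; case: RE => [-> | [a [b [ab -> Cab]]]]; first by left.
    right; exists a, b; split=> //; apply: has_copy_mono Cab => u v.
    by rewrite !joined_cons => /or3P[] ->; rewrite ?orbT.
  case: RE => [R0 | [a [b [ab RE Cab]]]].
    by left; right; split=> //; right; exists x, y; split=> //; rewrite R0.
  right; left; rewrite RE /=.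
  suff : (size B).+1 != l by have := size_copy _ Cab; rewrite /=; lia.
  apply: contraNneq Rxy => sB; rewrite RE.
  exact: tight_cycle_edge_unique sB ab Cab closes.
- right; split; last by left.
  by move/size_copy=> /=; lia.
Qed.

(** * The on-line Ramsey numbers *)

Lemma ceil_rounds l : absz (Num.ceil ((5 * l)%:R / 4%:R : rat)%R) = rounds l.
Proof.
rewrite (_ : Num.ceil _ = Posz (rounds l)) //; apply: Num.Theory.ceil_def.
have lo : 4 * rounds l <= 5 * l + 3 by rewrite /rounds; lia.
have hi : 5 * l <= 4 * rounds l by rewrite /rounds; lia.
move: lo hi; rewrite -!(Num.Theory.ler_nat rat) GRing.natrD !GRing.natrM.
rewrite GRing.rmorphB /= -pmulrn => lo hi.
apply/andP; split; lra.
Qed.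

Theorem theorem1p5 :
  (forall l : nat, 2 <= l ->
     online_ramsey_is (path_graph 3) (path_graph l.+1)
       (absz (Num.ceil ((5 * l)%:R / 4%:R : rat)%R)))
  /\
  (forall l : nat, l = 3 \/ l = 4 ->
     online_ramsey_is (path_graph 3) (cycle_graph l) (l + 2))
  /\
  (forall l : nat, 5 <= l ->
     online_ramsey_is (path_graph 3) (cycle_graph l)
       (absz (Num.ceil ((5 * l)%:R / 4%:R : rat)%R))).
Proof.
split=> [l _ | ]; last split=> l.
- rewrite ceil_rounds; split=> [|m]; first exact: path_upper.
  by apply: greedy_painter => E; apply: trail_of_path.
- move=> l34; split=> [|m]; last by rewrite addn2; apply: lazy_painter; lia.
  case: l34 => ->; first exact: triangle_upper.
  exact: (@cycle_upper 4).
- move=> l_ge5; rewrite ceil_rounds; split=> [|m].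
    have <- : maxn (rounds l) l.+2 = rounds l by rewrite /rounds; lia.
    by apply: cycle_upper; lia.
  apply: greedy_painter => E /trail_of_cycle[|u _ uv]; first by lia.
  by exists u, (u \o @ordS l).
Qed.
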